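(* Suppose $Q_1, Q_2, Q_3$ are positive-definite integer-valued binary quadratic forms satisfying the 3-term linear relation $$\alpha_1 \theta_{Q_1} + \alpha_2 \theta_{Q_2} + \alpha_3 \theta_{Q_3} = 0$$ for some $\alpha_1, \alpha_2, \alpha_3 \in \mathbb{R}$. Then, up to reordering of the indices $i \in \{1,2,3\}$, exactly one of the following holds: 1) (Degenerate solutions) All $\alpha_i = 0$, and all $Q_i$ are arbitrary. 2) (Trivial 2-term solutions) $\alpha_1 = -\alpha_2 \neq 0$, $\alpha_3 = 0$, $Q_1 \sim_{\mathbb{Z}} Q_2$, and $Q_3$ is arbitrary. 3) (Trivial 3-term solutions) All $\alpha_i \neq 0$, $\alpha_1+\alpha_2+\alpha_3 = 0$, and $Q_1 \sim_{\mathbb{Z}} Q_2 \sim_{\mathbb{Z}} Q_3$. 4) (Non-trivial 3-term solutions) $6\alpha_1 = 3\alpha_2 = -2\alpha_3 \neq 0$, giving the relation $$\tfrac{1}{3}\theta_{Q_1} + \tfrac{2}{3}\theta_{Q_2} = \theta_{Q_3},$$ where $$Q_1 \sim_{\mathbb{Z}} c(x^2+xy+y^2), \qquad Q_2 \sim_{\mathbb{Z}} 4c(x^2+xy+y^2), \qquad Q_3 \sim_{\mathbb{Z}} c(x^2+3y^2)$$ for some positive integer $c \in \mathbb{Z}_{>0}$.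
   Context: A positive-definite integer-valued binary quadratic form is $Q(x,y) = ax^2+bxy+cy^2$ with $a,b,c\in\mathbb{Z}$ that is positive definite (so $b^2-4ac<0$). For $m\in\mathbb{Z}_{\ge 0}$, $r_Q(m) := \#\{(x,y)\in\mathbb{Z}^2 : Q(x,y)=m\}$. The theta series of $Q$ is $\theta_Q(z) := \sum_{m\ge 0} r_Q(m) q^m$ with $q = e^{2\pi i z}$, $z$ in the upper half-plane. Two forms are $\mathbb{Z}$-equivalent, $Q\sim_{\mathbb{Z}} Q'$, if one is obtained from the other by a linear change of variables by a matrix in $\mathrm{GL}_2(\mathbb{Z})$. *)

(* Defs.v *)
From HB Require Import structures.
From mathcomp Require Import all_boot all_order all_algebra all_fingroup.
From mathcomp Require Import finmap.
From mathcomp Require Import all_classical all_reals all_analysis.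
From mathcomp Require Import complex.

Set Implicit Arguments.
Unset Strict Implicit.
Unset Printing Implicit Defensive.

Import Order.TTheory GRing.Theory Num.Theory.
Import numFieldNormedType.Exports.

Local Open Scope classical_set_scope.
Local Open Scope ring_scope.
Local Open Scope complex_scope.

(* The binary quadratic form a x^2 + b x y + c y^2. *)
Record bqf := BQF { qa : int; qb : int; qc : int }.

Definition qeval (A : comNzRingType) (Q : bqf) (x y : A) : A :=
  (qa Q)%:~R * x ^+ 2 + (qb Q)%:~R * x * y + (qc Q)%:~R * y ^+ 2.

Definition posdef (R : realType) (Q : bqf) : Prop :=
  forall x y : R, (x, y) != (0, 0) -> 0 < qeval Q x y.

(* Positive definiteness makes the set finite; [fset_set] of an infinite set
   would be empty. *)
Definition nreps (Q : bqf) (m : nat) : nat :=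
  #|` fset_set [set p : int * int | qeval Q p.1 p.2 = m%:Z] |.

Definition cexp (R : realType) (z : R[i]) : R[i] :=
  (expR (complex.Re z))%:C * (cos (complex.Im z) +i* sin (complex.Im z)).

Definition qparam (R : realType) (z : R[i]) : R[i] :=
  cexp (2 * (pi : R)%:C * 'i%C * z).

(* The ascription to [R[i]^o] selects the topology of the norm on R[i]. *)
Definition theta (R : realType) (Q : bqf) (z : R[i]) : R[i] :=
  limn (series (fun m => (nreps Q m)%:R * qparam z ^+ m : R[i]^o)).

Definition Zequiv (Q Q' : bqf) : Prop :=
  exists2 M : 'M[int]_2, M \in unitmx &
    forall x y : int, qeval Q' x y =
      qeval Q (M 0 0 * x + M 0 1 * y) (M 1 0 * x + M 1 1 * y).

(* Indices 1, 2, 3 of the three-term relation are 0, 1, 2 : 'I_3 below. *)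
Inductive solution_type :=
  Degenerate | Trivial2 | Trivial3 | Nontrivial3.

Definition has_type (R : realType) (t : solution_type)
    (alpha : 'I_3 -> R) (Q : 'I_3 -> bqf) : Prop :=
  match t with
  | Degenerate => forall i, alpha i = 0
  | Trivial2 =>
      [/\ alpha 0 = - alpha 1, alpha 0 != 0, alpha 2 = 0 & Zequiv (Q 0) (Q 1)]
  | Trivial3 =>
      [/\ forall i, alpha i != 0, alpha 0 + alpha 1 + alpha 2 = 0,
          Zequiv (Q 0) (Q 1) & Zequiv (Q 1) (Q 2)]
  | Nontrivial3 =>
      [/\ 6 * alpha 0 = 3 * alpha 1, 3 * alpha 1 = - 2 * alpha 2,
          - 2 * alpha 2 != 0,
          forall z : R[i], 0 < complex.Im z ->
            1 / 3 * theta (Q 0) z + 2 / 3 * theta (Q 1) z = theta (Q 2) z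
        & exists c : int,
          [/\ 0 < c, Zequiv (Q 0) (BQF c c c),
              Zequiv (Q 1) (BQF (4 * c) (4 * c) (4 * c))
            & Zequiv (Q 2) (BQF c 0 (3 * c))]]
  end.

(* Main.v *)
(* Restricting the relation to z = iy turns it into a vanishing real power
   series, so the representation numbers r_Q(m) satisfy the same linear relation
   for every m. Since r_Q(m) is the sum over d^2 | m of the number of primitive
   representations of m/d^2, induction on m transfers the relation to the number
   of primitive representations up to sign, which avoids counting multiples of
   short vectors.

   Every form is equivalent to some a x^2 + b x y + c y^2 with
   0 <= b <= a <= c, and the primitive values of such a form begin, in increasing
   order and with multiplicity, by a, c, a - b + c, a + b + c, 4a - 2b + c. The
   case m = 0 gives alpha_1 + alpha_2 + alpha_3 = 0, so that if no alpha_i vanishes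
   two of them have the same sign and p h_1 + q h_2 = (p + q) h_3 with p, q > 0 after
   reordering, where h_i counts primitive values. Comparing the smallest values on
   both sides forces h_1 = h_2 = h_3 or p : q in {1 : 1, 1 : 2, 2 : 1}; in the latter
   case looking at the next few values leaves only the hexagonal solution. *)
Require Import Defs.
From mathcomp Require Import all_boot all_order all_algebra all_fingroup.
From mathcomp Require Import finmap.
From mathcomp Require Import all_classical all_reals all_analysis.
From mathcomp Require Import complex.
From mathcomp Require Import zify ring lra.

Set Implicit Arguments.
Unset Strict Implicit.
Unset Printing Implicit Defensive.

Import Order.TTheory GRing.Theory Num.Theory.
Import numFieldNormedType.Exports.

(** * Profiles of primitive values, and tactics that compare them *)

(* Kept folded so that [lia] does not split on every occurrence. *)
Definition ind (x y : nat) : nat := x == y.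

Lemma ind0 x y : x <> y -> ind x y = 0.
Proof. by rewrite /ind; case: eqP. Qed.

Lemma ind1 x y : x = y -> ind x y = 1.
Proof. by rewrite /ind; case: eqP. Qed.

Lemma indP x y : x = y /\ ind x y = 1 \/ x <> y /\ ind x y = 0.
Proof. by rewrite /ind; case: eqP; [left | right]. Qed.

Definition vanish_below (v : nat) (t : nat -> nat) : Prop :=
  forall m, m < v -> t m = 0.

(* [h m] is the number of primitive vectors, up to sign, where
   a x^2 + b x y + c y^2 takes the value m; the contributions of (1, 0), (0, 1),
   (1, -1), (1, 1) are explicit, and (2, -1) reaches the bound v. When a = b = c,
   both (2, -1) and (1, -2) have value 3a, and the next value is 7a. *)
Definition profile (a b c : nat) (h : nat -> nat) : Prop :=
  exists d v t,
  [/\ 0 < a, b <= a, a <= c, d + b = a + c & v + 2 * b = 4 * a + c] /\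
  [/\ vanish_below v t, 0 < t v,
      a = b -> b = c -> forall m, m < 7 * a -> t m = 2 * ind (3 * a) m
    & forall m, h m = ind a m + ind c m + ind d m + ind (a + b + c) m + t m].

Lemma profile_hex (a : nat) (h : nat -> nat) : profile a a a h ->
  exists2 t, vanish_below (7 * a) t
    & forall m, h m = 3 * ind a m + 3 * ind (3 * a) m + t m.
Proof.
move=> [d [v [t [[a_gt0 _ _ dE vE] [_ _ /(_ erefl erefl) tE hE]]]]].
exists (fun m => t m - 2 * ind (3 * a) m) => [m /tE -> | m]; first by rewrite subnn.
have -> : 3 * a = a + a + a by lia.
rewrite hE; have -> : d = a by lia.
have : 2 * ind (a + a + a) m <= t m.
  case: (indP (a + a + a) m) => [ [E ->]|[_ ->]] //.
  by rewrite tE ?ind1; lia.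
lia.
Qed.

(** An indicator that [lia] cannot decide leaves the two-way disjunction of [indP]; an undecided
    tail value stays an unknown natural number with its defining equation. *)
Ltac decide_in H :=
  repeat match type of H with
  | context [ind ?x ?y] =>
      let n := fresh "n" in let E := fresh "E" in
      remember (ind x y) as n eqn:E in H;
      first [ rewrite -> (@ind0 x y ltac:(lia)) in E; subst n
            | rewrite -> (@ind1 x y ltac:(lia)) in E; subst n
            | pose proof (indP x y); rewrite <- E in *; clear E ]
  end;
  repeat match goal with
  | T : vanish_below ?v ?t |- _ =>
     match type of H with context [t ?m] =>
      let n := fresh "n" in let E := fresh "E" in
      remember (t m) as n eqn:E in H;
       first [ rewrite -> (T m ltac:(lia)) in E; subst n
             | idtac ] end
  end.

(* Evaluates the relation [R] at [m], computing each term whose position relative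
   to [m] follows from the context. *)
Ltac ev R m H := pose proof (R m ltac:(lia)) as H; decide_in H.
Ltac bad R m := exfalso; let H := fresh in ev R m H; lia.

(** * Comparison of the smallest primitive values *)

(** The value [a1] balances by itself, so the next value on the left, the smaller of [d1] and [a2],
    must equal [c3]. Here and in the next lemmas, if two candidates for the next value differ, the
    relation fails at the smaller one; counting multiplicities at their common value then restricts
    the coefficients. *)
Lemma square_case (a1 b1 a2 b2 c2 b3 c3 : nat) (h1 h2 h3 : nat -> nat) :
  profile a1 b1 a1 h1 -> profile a2 b2 c2 h2 -> profile a1 b3 c3 h3 ->
  b1 < a1 -> a1 < a2 -> a1 < c3 ->
  ~ (forall m, 0 < m -> h1 m + h2 m = 2 * h3 m).
Proof.
move=> [d1 [v1 [t1 [[a1_gt0 ba1 ac1 d1E v1E] [T1 tv1 _ h1E]]]]].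
move=> [d2 [v2 [t2 [[a2_gt0 ba2 ac2 d2E v2E] [T2 tv2 _ h2E]]]]].
move=> [d3 [v3 [t3 [[a3_gt0 ba3 ac3 d3E v3E] [T3 tv3 _ h3E]]]]].
move=> b1a a12 ac hR.
have {h1E h2E h3E hR} R m : 0 < m ->
  ind a1 m + ind a1 m + ind d1 m + ind (a1 + b1 + a1) m + t1 m +
  (ind a2 m + ind c2 m + ind d2 m + ind (a2 + b2 + c2) m + t2 m) =
  2 * (ind a1 m + ind c3 m + ind d3 m + ind (a1 + b3 + c3) m + t3 m).
  by move=> /hR; rewrite h1E h2E h3E.
case: (ltngtP d1 a2) => [da|ad|da].
- have ? : c3 = d1.
    by case: (ltngtP c3 d1) => // ?; [bad R c3 | bad R d1].
  subst c3.
  have [b10 b3a] : b1 = 0 /\ b3 < a1 by ev R d1 H; lia.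
  subst b1.
  have ? : a2 = d3.
    by case: (ltngtP a2 d3) => // ?; [bad R a2 | bad R d3].
  subst a2.
  have [b30 [c2E b2a]] : 0 < b3 /\ c2 = d3 /\ b2 < d3 by ev R d3 H; lia.
  subst c2.
  case: (ltngtP d2 (a1 + b3 + d1)) => [?|?|E]; [bad R d2|bad R (a1 + b3 + d1)|].
  by ev R d2 H; lia.
- have ? : c3 = a2.
    by case: (ltngtP c3 a2) => // ?; [bad R c3 | bad R a2].
  subst c3.
  have [b3a [c2E b2a]] : b3 < a1 /\ c2 = a2 /\ b2 < a2 by ev R a2 H; lia.
  subst c2.
  case: (ltngtP d1 d2) => [d12|d21|d12].
  + have ? : d3 = d1.
      by case: (ltngtP d3 d1) => // ?; [bad R d3 | bad R d1].
    have [b30 b10] : 0 < b3 /\ b1 = 0 by ev R d1 H; lia.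
    have ? : d2 = a1 + b3 + a2.
      by case: (ltngtP d2 (a1 + b3 + a2)) => // ?; [bad R d2 | bad R (a1 + b3 + a2)].
    have b20 : b2 = 0 by ev R d2 H; lia.
    (* Both forms on the left are now multiples of x^2 + y^2, and the value of the third form at (2,
       -1) is not matched by any of theirs. *)
    by ev R v3 H; lia.
  + have ? : d3 = d2.
      by case: (ltngtP d3 d2) => // ?; [bad R d3 | bad R d2].
    by ev R d2 H; lia.
  + have ? : d3 = d1.
      by case: (ltngtP d3 d1) => // ?; [bad R d3 | bad R d1].
    have b10 : 0 < b1 by ev R d1 H; lia.
    by bad R (a1 + b1 + a1).
- subst a2.
  have ? : c3 = d1.
    by case: (ltngtP c3 d1) => // ?; [bad R c3 | bad R d1].
  subst c3.
  (* At [d1] the right side counts 2 or 4, and the left side counts 1 or 2 from [h1] plus 1, 2 or 3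
     from [h2]; these are the ways to agree. *)
  have cases : [\/ [/\ 0 < b1, d1 < c2 & b3 < a1],
     [/\ 0 < b1, c2 = d1, b2 = d1 & b3 = a1] | [/\ b1 = 0, c2 = d1, b2 < d1 & b3 = a1]].
    ev R d1 H.
    case: (posnP b1) => ?; first by constructor 3; split; lia.
    case: (ltngtP d1 c2) => ?; [by constructor 1; split; lia|lia|].
    by constructor 2; split; lia.
  case: cases => [ [b10 dc b3a]|[b10 c2E b2E b3E]|[b10 c2E b2E b3E]].
  + case: (ltngtP c2 (a1 + b1 + a1)) => [cs|sc|cs].
    * have ? : d3 = c2.
        by case: (ltngtP d3 c2) => // ?; [bad R d3 | bad R c2].
      have [b30 b2E] : 0 < b3 /\ b2 = d1 by ev R c2 H; lia.
      by bad R (a1 + b1 + a1).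
    * have ? : d3 = a1 + b1 + a1.
        by case: (ltngtP d3 (a1 + b1 + a1)) => // ?; [bad R d3 | bad R (a1 + b1 + a1)].
      by bad R (a1 + b1 + a1).
    * have ? : d3 = c2.
        by case: (ltngtP d3 c2) => // ?; [bad R d3 | bad R c2].
      have [b30 b2E] : 0 < b3 /\ b2 < d1 by ev R c2 H; lia.
      have ? : d2 = a1 + b3 + d1.
        by case: (ltngtP d2 (a1 + b3 + d1)) => // ?; [bad R d2 | bad R (a1 + b3 + d1)].
      by ev R d2 H; lia.
  + by bad R (a1 + b1 + a1).
  (* The third form takes the value [v3] at both (1, 1) and (2, -1), giving at least 4 on the right
     against at most 2 on the left. *)
  + by bad R v3.
Qed.

(** Right counts are multiples of 3, and so are the hexagonal counts below [7 * a1]. Hence [h2] is a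
    multiple of 3 at each such value, and the minimum of the second form can only be attained three
    times. *)
Lemma hex_third_case (a1 a2 b2 c2 b3 c3 : nat) (h1 h2 h3 : nat -> nat) :
  profile a1 a1 a1 h1 -> profile a2 b2 c2 h2 -> profile a1 b3 c3 h3 ->
  a1 < a2 -> a1 < c3 ->
  (forall m, 0 < m -> h1 m + 2 * h2 m = 3 * h3 m) ->
  [/\ a2 = 4 * a1, b2 = 4 * a1, c2 = 4 * a1, b3 = 0 & c3 = 3 * a1].
Proof.
move=> /profile_hex [t1 T1 h1E].
move=> [d2 [v2 [t2 [[a2_gt0 ba2 ac2 d2E v2E] [T2 tv2 _ h2E]]]]].
move=> [d3 [v3 [t3 [[a3_gt0 ba3 ac3 d3E v3E] [T3 tv3 _ h3E]]]]].
move=> a12 ac hR.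
have {h1E h2E h3E hR} R m : 0 < m ->
  3 * ind a1 m + 3 * ind (3 * a1) m + t1 m +
  2 * (ind a2 m + ind c2 m + ind d2 m + ind (a2 + b2 + c2) m + t2 m) =
  3 * (ind a1 m + ind c3 m + ind d3 m + ind (a1 + b3 + c3) m + t3 m).
  by move=> /hR; rewrite h1E h2E h3E.
case: (ltngtP (3 * a1) a2) => [aa|aa|aa].
- have ? : c3 = 3 * a1.
    by case: (ltngtP c3 (3 * a1)) => // ?; [bad R c3 | bad R (3 * a1)].
  subst c3.
  have b3a : b3 < a1 by ev R (3 * a1) H; lia.
  have ? : a2 = d3.
    by case: (ltngtP a2 d3) => // ?; [bad R a2 | bad R d3].
  by ev R d3 H; split; lia.
- have ? : c3 = a2.
    by case: (ltngtP c3 a2) => // ?; [bad R c3 | bad R a2].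
  subst c3.
  have [b3a c2E b2a] : [/\ b3 = a1, c2 = a2 & b2 = a2] by ev R a2 H; split; lia.
  by bad R (a1 + b3 + a2).
- have ? : c3 = a2.
    by case: (ltngtP c3 a2) => // ?; [bad R c3 | bad R a2].
  by bad R a2.
Qed.

(** Divisibility by 3 again makes the second form hexagonal, and then [a1 + b3 + a1] is a value on
    the right alone. *)
Lemma hex_two_thirds_case (a1 a2 b2 c2 b3 : nat) (h1 h2 h3 : nat -> nat) :
  profile a1 a1 a1 h1 -> profile a2 b2 c2 h2 -> profile a1 b3 a1 h3 ->
  b3 < a1 -> a1 < a2 ->
  ~ (forall m, 0 < m -> 2 * h1 m + h2 m = 3 * h3 m).
Proof.
move=> /profile_hex [t1 T1 h1E].
move=> [d2 [v2 [t2 [[a2_gt0 ba2 ac2 d2E v2E] [T2 tv2 _ h2E]]]]].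
move=> [d3 [v3 [t3 [[a3_gt0 ba3 ac3 d3E v3E] [T3 tv3 _ h3E]]]]].
move=> ba a12 hR.
have {h1E h2E h3E hR} R m : 0 < m ->
  2 * (3 * ind a1 m + 3 * ind (3 * a1) m + t1 m) +
  (ind a2 m + ind c2 m + ind d2 m + ind (a2 + b2 + c2) m + t2 m) =
  3 * (ind a1 m + ind a1 m + ind d3 m + ind (a1 + b3 + a1) m + t3 m).
  by move=> /hR; rewrite h1E h2E h3E.
have ? : a2 = d3.
  by case: (ltngtP a2 d3) => // ?; [bad R a2 | bad R d3].
subst a2.
have [b3_gt0 c2E b2E] : [/\ 0 < b3, c2 = d3 & b2 = d3] by ev R d3 H; split; lia.
by bad R (a1 + b3 + a1).
Qed.

(** The first form takes the value [c] at both (0, 1) and (1, -1), which balances the right side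
    there, so [c2] must be [d3]. Counting at [d3] gives [b2 = a], and [a + b3 + c] then lies
    strictly below every value still available on the left. *)
Lemma isosceles_case (a c b2 c2 b3 : nat) (h1 h2 h3 : nat -> nat) :
  profile a a c h1 -> profile a b2 c2 h2 -> profile a b3 c h3 ->
  b3 < a -> c < c2 ->
  ~ (forall m, 0 < m -> h1 m + h2 m = 2 * h3 m).
Proof.
move=> [d1 [v1 [t1 [[a1_gt0 ba1 ac1 d1E v1E] [T1 tv1 _ h1E]]]]].
move=> [d2 [v2 [t2 [[a2_gt0 ba2 ac2 d2E v2E] [T2 tv2 _ h2E]]]]].
move=> [d3 [v3 [t3 [[a3_gt0 ba3 ac3 d3E v3E] [T3 tv3 _ h3E]]]]].
move=> b1a c12 hR.
have {h1E h2E h3E hR} R m : 0 < m ->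
  ind c m + ind d1 m + ind (a + a + c) m + t1 m +
  (ind c2 m + ind d2 m + ind (a + b2 + c2) m + t2 m) =
  2 * (ind c m + ind d3 m + ind (a + b3 + c) m + t3 m).
  by move=> /hR; rewrite h1E h2E h3E; lia.
have ? : c2 = d3.
  by case: (ltngtP c2 d3) => // ?; [bad R c2 | bad R d3].
subst c2.
have [b3_gt0 b2E] : 0 < b3 /\ b2 = a by ev R d3 H; lia.
by bad R (a + b3 + c).
Qed.

Local Open Scope ring_scope.

(** With real weights, each undecided indicator is split into its two cases so that [lra] sees
    numeric multiplicities. *)
Ltac evr S m H :=
  ev S m H;
  repeat match goal with D : (_ = _ /\ _ = _) \/ (_ <> _ /\ _ = _) |- _ =>
    let E := fresh in destruct D as [[? E] | [? E]]; rewrite -> E in H; try (exfalso; lia)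
  end; rewrite ?(addn0, add0n) ?natrD /= in H.
Ltac absurdr := exfalso; solve [lia | lra].
Ltac badr S m := let H := fresh in evr S m H; absurdr.

(** The order hypotheses put first the form whose values come earlier; a larger [b] gives a smaller
    [d], hence the reversed inequality between [b1] and [b2]. With equal minima the forms coincide
    step by step, and with [a1 < a2] the first and third forms share their minimum. *)
Lemma profile_relation (R : realFieldType) (p q : R)
    (a1 b1 c1 a2 b2 c2 a3 b3 c3 : nat) (h1 h2 h3 : nat -> nat) :
  profile a1 b1 c1 h1 -> profile a2 b2 c2 h2 -> profile a3 b3 c3 h3 ->
  0 < p -> 0 < q -> (a1 <= a2)%N -> (a1 = a2 -> c1 <= c2)%N ->
  (a1 = a2 -> c1 = c2 -> b2 <= b1)%N ->
  (forall m, (0 < m)%N ->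
     p * (h1 m)%:R + q * (h2 m)%:R = (p + q) * (h3 m)%:R) ->
  [/\ (a1, b1, c1) = (a3, b3, c3) & (a2, b2, c2) = (a3, b3, c3)] \/
  [/\ q = 2 * p, (a1, b1, c1) = (a1, a1, a1),
      (a2, b2, c2) = (4 * a1, 4 * a1, 4 * a1)%N
    & (a3, b3, c3) = (a1, 0, 3 * a1)%N].
Proof.
move=> P1 P2 P3 p0 q0 a12 c12 b12 hR.
have half : p = q -> forall m, (0 < m -> h1 m + h2 m = 2 * h3 m)%N.
  move=> pq m /hR; rewrite -pq => E; apply/eqP; rewrite -(eqr_nat R) natrD natrM.
  apply/eqP; apply: (mulfI (lt0r_neq0 p0)); lra.
have third : q = 2 * p -> forall m, (0 < m -> h1 m + 2 * h2 m = 3 * h3 m)%N.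
  move=> pq m /hR; rewrite pq => E; apply/eqP; rewrite -(eqr_nat R) natrD !natrM.
  apply/eqP; apply: (mulfI (lt0r_neq0 p0)); lra.
have thirds : p = 2 * q -> forall m, (0 < m -> 2 * h1 m + h2 m = 3 * h3 m)%N.
  move=> pq m /hR; rewrite pq => E; apply/eqP; rewrite -(eqr_nat R) natrD !natrM.
  apply/eqP; apply: (mulfI (lt0r_neq0 q0)); lra.
move: (P1) => [d1 [v1 [t1 [[a1_gt0 ba1 ac1 d1E v1E] [T1 tv1 _ h1E]]]]].
move: (P2) => [d2 [v2 [t2 [[a2_gt0 ba2 ac2 d2E v2E] [T2 tv2 _ h2E]]]]].
move: (P3) => [d3 [v3 [t3 [[a3_gt0 ba3 ac3 d3E v3E] [T3 tv3 _ h3E]]]]].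
have {h1E h2E h3E hR} S m : (0 < m)%N ->
  p * (ind a1 m + ind c1 m + ind d1 m + ind (a1 + b1 + c1) m + t1 m)%:R +
  q * (ind a2 m + ind c2 m + ind d2 m + ind (a2 + b2 + c2) m + t2 m)%:R =
  (p + q) * (ind a3 m + ind c3 m + ind d3 m + ind (a3 + b3 + c3) m + t3 m)%:R.
  by move=> /hR; rewrite h1E h2E h3E.
case: (ltngtP a1 a2) a12 c12 b12 => // [a12 _ _ _|a12 _ c12 b12]; last first.
  move: (c12 a12) (b12 a12) => {}c12 {}b12; subst a2; left.
  have ? : a3 = a1 by case: (ltngtP a3 a1) => // ?; [badr S a3 | badr S a1].
  subst a3.
  have ? : c3 = c1 by case: (ltngtP c3 c1) => // ?; [badr S c3 | badr S c1].
  subst c3.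
  case: (ltngtP c1 c2) c12 b12 => // [{}c12 _ _|{}c12 _ /(_ c12) {}b12].
    have [pq ? b3a] : [/\ p = q, b1 = a1 & (b3 < a1)%N].
      by evr S c1 H; solve [absurdr | split; [lra | lia | lia]].
    subst.
    by case: (isosceles_case P1 P2 P3 b3a c12 (half erefl)).
  subst c2.
  have ? : d3 = d1 by case: (ltngtP d3 d1) => // ?; [badr S d3 | badr S d1].
  case: (ltngtP d1 d2) => [d12|d12|d12]; [by badr S d1|lia|].
  by split; congr (_, _, _); lia.
have ? : a3 = a1 by case: (ltngtP a3 a1) => // ?; [badr S a3 | badr S a1].
subst a3; right.
(* If the minimum is attained n1 and n3 times by the first and third forms, then p n1 = (p + q) n3
   with n3 < n1 <= 3, so (n1, n3) is (2, 1), (3, 1) or (3, 2). *)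
have cases : [\/ [/\ c1 = a1, (b1 < a1)%N, (a1 < c3)%N & p = q],
   [/\ c1 = a1, b1 = a1, (a1 < c3)%N & q = 2 * p] |
   [/\ c1 = a1, b1 = a1, c3 = a1, (b3 < a1)%N & p = 2 * q]].
  evr S a1 H; solve [absurdr
    | constructor 1; split; [lia | lia | lia | lra]
    | constructor 2; split; [lia | lia | lia | lra]
    | constructor 3; split; [lia | lia | lia | lia | lra]].
case: cases => [ [? b1a ac3' pq]|[? ? ac3' pq]|[? ? ? b3a pq]]; subst.
- by case: (square_case P1 P2 P3 b1a a12 ac3' (half erefl)).
- by case: (hex_third_case P1 P2 P3 a12 ac3' (third erefl)) => -> -> -> -> ->.
- by case: (hex_two_thirds_case P1 P2 P3 b3a a12 (thirds erefl)).
Qed.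

Local Open Scope classical_set_scope.
Local Open Scope complex_scope.
Local Open Scope ring_scope.

(** * Estimates for reduced forms *)

Definition reduced (Q : bqf) : Prop :=
  [/\ 0 < qa Q, 0 <= qb Q, qb Q <= qa Q & qa Q <= qc Q].

Lemma qeval_int (Q : bqf) (x y : int) :
  qeval Q x y = qa Q * x ^+ 2 + qb Q * x * y + qc Q * y ^+ 2.
Proof. by rewrite /qeval !intz. Qed.

Lemma reduced_lower (a b c x y : int) : 0 <= b ->
  a * `|x| ^+ 2 - b * (`|x| * `|y|) + c * `|y| ^+ 2 <= a * x ^+ 2 + b * x * y + c * y ^+ 2.
Proof.
move=> b0; rewrite !real_normK ?num_real // lerD2r lerD2l -mulrN -mulrA.
by rewrite ler_wpM2l // -normrM lerNl -normrN ler_norm.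
Qed.

(** With X = |x| and Y = |y|, twice the lower bound of [reduced_lower] is b (X - Y)^2 + (2a - b) X^2
    + (2c - b) Y^2, where 2a - b and 2c - b are at least 1. *)
Lemma reduced_box (Q : bqf) (x y : int) : reduced Q ->
  `|x| <= 2 * qeval Q x y /\ `|y| <= 2 * qeval Q x y.
Proof.
move=> [a0 b0 ba ac]; have := reduced_lower (qa Q) (qc Q) x y b0.
rewrite -qeval_int; move: (qeval Q x y) (normr_ge0 x) (normr_ge0 y) => q.
move: `|x| `|y| => X Y X0 Y0 H.
have H1 : (X - Y) ^+ 2 * qb Q + X ^+ 2 + Y ^+ 2 <= 2 * q.
  have := mulr_ge0 (_ : 0 <= 2 * qa Q - qb Q - 1) (sqr_ge0 X).
  have := mulr_ge0 (_ : 0 <= 2 * qc Q - qb Q - 1) (sqr_ge0 Y).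
  move=> /(_ ltac:(lia)) + /(_ ltac:(lia)); nia.
have := mulr_ge0 (sqr_ge0 (X - Y)) b0; nia.
Qed.

(** In the decomposition [E] the two last terms grow with |x| and |y|, and the first is at least b
    unless |x| = |y|; the resulting minimum is the value at (2, -1). *)
Lemma reduced_tail (Q : bqf) (x y : int) : reduced Q ->
  x != 0 -> y != 0 -> (1 < `|x|) || (1 < `|y|) ->
  4 * qa Q + qc Q - 2 * qb Q <= qeval Q x y.
Proof.
move=> [a0 b0 ba ac] x0 y0 xy; have := reduced_lower (qa Q) (qc Q) x y b0.
rewrite -qeval_int; apply: le_trans.
have : 1 <= `|x| by lia.
have : 1 <= `|y| by lia.
move: `|x| `|y| xy => X Y xy Y1 X1.
have ea : 0 <= 2 * qa Q - qb Q by lia.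
have ec : 0 <= 2 * qc Q - qb Q by lia.
have E : 2 * (qa Q * X ^+ 2 - qb Q * (X * Y) + qc Q * Y ^+ 2) =
  qb Q * (X - Y) ^+ 2 + (2 * qa Q - qb Q) * X ^+ 2 + (2 * qc Q - qb Q) * Y ^+ 2.
  by ring.
have mono (k u : int) (n : int) : 0 <= k -> 0 <= n -> n <= u -> k * n ^+ 2 <= k * u ^+ 2.
  by move=> k0 n0 nu; rewrite ler_wpM2l // ler_sqr // nnegrE; lia.
have [XY|XY] := eqVneq X Y.
  subst Y; have X2 : 2 <= X by lia.
  have := mono _ _ 2 ea isT X2; have := mono _ _ 2 ec isT X2.
  rewrite subrr expr0n mulr0 add0r in E; lia.
pose q := qb Q; have b1 : q * 1 <= q * (X - Y) ^+ 2.
  rewrite ler_wpM2l // -real_normK ?num_real // exprn_ege1 //.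
  by move: XY; rewrite -subr_eq0 -normr_gt0; lia.
rewrite /q mulr1 in b1.
have [X2|X2] := leP 2 X.
  have := mono _ _ 2 ea isT X2; have := mono _ _ 1 ec isT Y1; lia.
have Y2 : 2 <= Y by lia.
have := mono _ _ 1 ea isT X1; have := mono _ _ 2 ec isT Y2; lia.
Qed.

Lemma hex_values (x y : int) : coprimez x y -> x ^+ 2 + x * y + y ^+ 2 < 7 ->
  (0 < x) || (x == 0) && (0 < y) ->
  (x, y) \in [:: (1, 0); (0, 1); (1, -1); (1, 1); (2, -1); (1, -2)].
Proof.
move=> cop lt7 half.
(* Since 4 (x^2 + x y + y^2) >= 3 x^2, and likewise for y, only finitely many vectors remain to be
   checked. *)
have x3 : `|x| <= 3 by nia.
have y3 : `|y| <= 3 by nia.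
move: x y x3 y3 cop lt7 half => [ [|[|[|[|x]]]]|[|[|[|x]]]] [[|[|[|[|y]]]]|[|[|[|y]]]] //=.
Qed.

(** * Representation numbers and primitive representations *)

Definition int_box (N : nat) : {fset int * int} :=
  seq_fset tt [seq (i%:Z - N%:Z, j%:Z - N%:Z) | i <- iota 0 (2 * N).+1, j <- iota 0 (2 * N).+1].

Lemma card_int_box N : (#|` int_box N| <= (2 * N).+1 ^ 2)%N.
Proof.
rewrite size_seq_fset; apply: leq_trans (size_undup _) _.
by rewrite size_allpairs size_iota.
Qed.

Lemma mem_int_box N (p : int * int) :
  `|p.1| <= N%:Z -> `|p.2| <= N%:Z -> p \in int_box N.
Proof.
case: p => x y /= xN yN; rewrite seq_fsetE.
apply/allpairsP; exists (`|(x + N%:Z)%R|%N, `|(y + N%:Z)%R|%N).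
by split; rewrite ?mem_iota /=; [lia|lia|congr (_, _); lia].
Qed.

Definition reps (Q : bqf) (m : nat) : set (int * int) :=
  [set p | qeval Q p.1 p.2 = m%:Z]%classic.

(* A choice of one vector in each pair (p, -p) of nonzero vectors. *)
Definition upper_half (p : int * int) : bool := (0 < p.1) || (p.1 == 0) && (0 < p.2).

Definition primitive (p : int * int) : bool := coprimez p.1 p.2 && upper_half p.

Definition prim_reps (Q : bqf) (m : nat) : {fset int * int} :=
  [fset p in fset_set (reps Q m) | primitive p]%fset.

Definition prim_count (Q : bqf) (m : nat) : nat := #|` prim_reps Q m|.

Lemma reps_sub_box Q m : reduced Q -> (reps Q m `<=` [set` int_box (2 * m)])%classic.
Proof.
move=> redQ p /= E; have [] := reduced_box p.1 p.2 redQ; rewrite E => xm ym.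
by apply: mem_int_box; rewrite ?PoszM.
Qed.

Lemma finite_reps Q m : reduced Q -> finite_set (reps Q m).
Proof. by move=> redQ; apply: sub_finite_set (reps_sub_box redQ) (finite_fset _). Qed.

Lemma in_reps Q m p : reduced Q ->
  (p \in fset_set (reps Q m)) = (qeval Q p.1 p.2 == m%:Z).
Proof.
move=> redQ; rewrite in_fset_set; last exact: finite_reps.
by apply/idP/eqP; rewrite inE.
Qed.

Lemma nreps_le Q m : reduced Q -> (nreps Q m <= (4 * m).+1 ^ 2)%N.
Proof.
move=> redQ; have -> : (4 * m = 2 * (2 * m))%N by lia.
apply: leq_trans (card_int_box _); apply: fsubset_leq_card.
apply/fsubsetP => p; rewrite in_fset_set; last exact: finite_reps.
by rewrite inE => /(reps_sub_box redQ).
Qed.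

Lemma in_prim Q m p : reduced Q ->
  (p \in prim_reps Q m) = (qeval Q p.1 p.2 == m%:Z) && primitive p.
Proof. by move=> redQ; rewrite !inE /= in_reps. Qed.

Lemma qevalZ (Q : bqf) (k x y : int) :
  qeval Q (k * x) (k * y) = k ^+ 2 * qeval Q x y.
Proof. by rewrite !qeval_int; ring. Qed.

Lemma gcd_sqr_dvd (Q : bqf) (m : nat) (p : int * int) : (0 < m)%N ->
  qeval Q p.1 p.2 = m%:Z ->
  (0 < `|gcdz p.1 p.2|)%N /\ (`|gcdz p.1 p.2| ^ 2 %| m)%N.
Proof.
move=> m0.
have /dvdzP[u uE] := dvdz_gcdl p.1 p.2.
have /dvdzP[v vE] := dvdz_gcdr p.1 p.2.
move: uE vE; move: (gcdz p.1 p.2) => g -> ->.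
rewrite ![_ * g]mulrC qevalZ => E; split.
  by rewrite absz_gt0; apply: contraTneq m0 => g0; move: E; rewrite g0 expr0n mul0r; lia.
apply/dvdnP; exists `|qeval Q u v|%N.
by rewrite -abszX -abszM mulrC E.
Qed.

(** Dividing a vector of gcd d by d gives a primitive vector up to sign; [upper_half] keeps one
    vector of each pair, hence the factor 2. *)
Lemma reps_gcd Q m d : reduced Q -> (0 < m)%N ->
  #|` [fset p in fset_set (reps Q m) | `|gcdz p.1 p.2|%N == d]%fset| =
  (if (0 < d) && (d ^ 2 %| m) then 2 * prim_count Q (m %/ d ^ 2) else 0)%N.
Proof.
move=> redQ m0.
have inG p : (p \in [fset p in fset_set (reps Q m) | `|gcdz p.1 p.2|%N == d]%fset) =
    (qeval Q p.1 p.2 == m%:Z) && (`|gcdz p.1 p.2|%N == d).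
  by rewrite !inE /= in_reps.
case: ifP => [/andP[d0 /dvdnP[n mE]]|nd].
  have -> : (m %/ d ^ 2 = n)%N by rewrite mE mulnK // expn_gt0 d0.
  have mZ : m%:Z = d%:Z ^+ 2 * n%:Z by rewrite mE -mulnn !PoszM expr2 mulrC.
  pose f (e : int) (p : int * int) := (e * d%:Z * p.1, e * d%:Z * p.2).
  have f_inj e : e != 0 -> injective (f e).
    move=> e0 [x y] [x' y'] [/mulfI E1 /mulfI E2]; congr (_, _); [apply: E1 | apply: E2];
    by rewrite mulf_neq0 //; lia.
  have -> : [fset p in fset_set (reps Q m) | `|gcdz p.1 p.2|%N == d]%fset =
      (f 1 @` prim_reps Q n `|` f (-1) @` prim_reps Q n)%fset.
    apply/fsetP => p; rewrite in_fsetU inG.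
    apply/andP/orP => [ [/eqP pm /eqP gE]|].
      have g0 : d%:Z != 0 by lia.
      have gE' : gcdz p.1 p.2 = d%:Z by rewrite -gE abszE ger0_norm.
      have [u uE] : exists u, p.1 = d%:Z * u.
        by have /dvdzP[u ->] := dvdz_gcdl p.1 p.2; exists u; rewrite gE' mulrC.
      have [v vE] : exists v, p.2 = d%:Z * v.
        by have /dvdzP[v ->] := dvdz_gcdr p.1 p.2; exists v; rewrite gE' mulrC.
      have cop : gcdz u v = 1.
        apply: (mulfI g0); rewrite mulr1 -[RHS]gE' uE vE.
        by have := mulz_gcdr d%:Z u v; rewrite absz_nat.
      have Qn : qeval Q u v = n%:Z.
        move: pm; rewrite uE vE qevalZ mZ => /mulfI; apply.
        by rewrite expf_neq0.
      have uvP : primitive (u, v) \/ primitive (- u, - v).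
        rewrite /primitive /upper_half /= /coprimez gcdNz gcdzN cop eqxx /=.
        have : (u != 0) || (v != 0).
          by rewrite -negb_and; apply/negP => /andP[/eqP u0 /eqP v0]; rewrite u0 v0 in cop.
        lia.
      case: uvP => pP; [left|right]; apply/imfsetP => /=.
        exists (u, v); last by rewrite /f mul1r -uE -vE; case: p {pm gE gE' uE vE}.
        by rewrite in_prim //= Qn eqxx.
      exists (- u, - v); last first.
        rewrite /f /= !mulN1r !mulrNN -uE -vE; by case: p {pm gE gE' uE vE}.
      by rewrite in_prim //= -mulN1r -(mulN1r v) qevalZ sqrrN expr1n mul1r Qn eqxx ?mulN1r.
    have main e q : e ^+ 2 = 1 -> q \in prim_reps Q n ->
        (qeval Q (f e q).1 (f e q).2 == m) && (`|gcdz (f e q).1 (f e q).2|%N == d).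
      move=> e1; rewrite in_prim // => /andP[/eqP qn /andP[cop _]].
      rewrite /f /= qevalZ qn exprMn e1 mul1r mZ eqxx /=.
      have e_abs : `|e|%N = 1%N.
        by have /eqP := e1; rewrite sqrf_eq1 => /orP[]/eqP->.
      rewrite !abszM e_abs mul1n absz_nat -muln_gcdr.
      by move: cop; rewrite coprimezE => /eqP ->; rewrite muln1.
    by case=> /imfsetP[q qP ->]; apply/andP; apply: main; rewrite ?sqrrN ?expr1n.
  rewrite cardfsU.
  (* A common element would put a vector and its opposite both in the upper half. *)
  have -> : (f 1 @` prim_reps Q n `&` f (-1) @` prim_reps Q n = fset0)%fset.
    apply/eqP; rewrite -fsubset0; apply/fsubsetP => _ /fsetIP[/imfsetP[q /= qP ->]].
    move=> /imfsetP[r /= rP] [] /eqP E1 /eqP E2.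
    move: qP rP; rewrite !in_prim // => /andP[_ /andP[_ +]] /andP[_ /andP[_ +]].
    have d0' : d%:Z != 0 by lia.
    move: E1 E2; rewrite !mulN1r !mul1r !mulNr -!mulrN !(inj_eq (mulfI d0')).
    by rewrite /upper_half => /eqP-> /eqP->; lia.
  have cardf e : e != 0 -> #|` (f e @` prim_reps Q n)%fset| = prim_count Q n.
    by move=> e0; apply/eqP/card_in_imfsetP => x y _ _; exact: f_inj.
  by rewrite cardfs0 subn0 !cardf // addnn -mul2n.
apply/eqP; rewrite cardfs_eq0 -fsubset0; apply/fsubsetP => p.
rewrite inG => /andP[/eqP E /eqP gE].
have [g0 gm] := gcd_sqr_dvd m0 E.
by rewrite -gE g0 gm in nd.
Qed.

Lemma nreps_prim Q m : reduced Q -> (0 < m)%N ->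
  nreps Q m = (\sum_(d < m.+1)
    if (0 < d) && (d ^ 2 %| m) then 2 * prim_count Q (m %/ d ^ 2) else 0)%N.
Proof.
move=> redQ m0; rewrite /nreps -/(reps Q m) card_fset_sum1.
rewrite (partition_big (fun p : int * int => inord `|gcdz p.1 p.2|%N : 'I_m.+1)
  xpredT) //=.
apply: eq_bigr => d _; rewrite -reps_gcd // card_fset_sum1 big_fset_condE.
apply: eq_fbigl => p; rewrite !inE /= in_reps //; apply: andb_id2l => /eqP E.
(* The square of the gcd divides [m], so the gcd is at most [m] and [inord] does not alter it. *)
rewrite -val_eqE /= inordK //.
have [g0 gm] := gcd_sqr_dvd m0 E.
by rewrite ltnS; apply: leq_trans (dvdn_leq m0 gm); rewrite -mulnn leq_pmulr.
Qed.

Lemma primitive_cases (p : int * int) : primitive p ->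
  [\/ p \in [:: (1, 0); (0, 1); (1, -1); (1, 1)] |
      [/\ p.1 != 0, p.2 != 0 & (1 < `|p.1|) || (1 < `|p.2|)]].
Proof.
case: p => x y /andP[/=]; rewrite /upper_half /=.
have [->|x0] := eqVneq x 0.
  rewrite /coprimez gcd0z => /eqP y1 hy; left.
  by have -> : y = 1 by lia.
have [->|y0] := eqVneq y 0.
  rewrite /coprimez gcdz0 => /eqP y1 hy; left.
  by have -> : x = 1 by lia.
move=> _ hx; have [|h] := boolP ((1 < `|x|) || (1 < `|y|)); first by right.
left; have -> : x = 1 by lia.
have [->|->] : y = 1 \/ y = -1 by lia.
all: by rewrite !inE.
Qed.

Lemma cardfs_split (T : choiceType) (A : {fset T}) (s : seq T) : uniq s ->
  #|` A| = (count (mem A) s + #|` [fset p in A | p \notin s]%fset|)%N.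
Proof.
elim: s => [|x s IH] /=.
  by rewrite add0n => _; congr #|` _|; apply/fsetP => p; rewrite !inE andbT.
move=> /andP[xs /IH ->]; rewrite -addnA addnCA; congr addn.
rewrite (cardfsD1 x) !inE xs andbT; congr (_ + #|` _|)%N.
by apply/fsetP => p; rewrite !inE negb_or; case: (p \in A); rewrite ?andbF.
Qed.

(** A primitive vector outside the four explicit ones has nonzero coordinates, one of them at least
    2 in absolute value, so [reduced_tail] bounds its value from below by the one at (2, -1). *)
Lemma prim_count_profile (Q : bqf) : reduced Q ->
  profile `|qa Q| `|qb Q| `|qc Q| (prim_count Q).
Proof.
move=> redQ; have [a0 b0 ba ac] := redQ.
pose s : seq (int * int) := [:: (1, 0); (0, 1); (1, -1); (1, 1)].
pose T m := [fset p in prim_reps Q m | p \notin s]%fset.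
exists `|(qa Q - qb Q + qc Q)%R|%N, `|(4 * qa Q - 2 * qb Q + qc Q)%R|%N.
exists (fun m => #|` T m|).
have inT m p : (p \in T m) = [&& qeval Q p.1 p.2 == m%:Z, primitive p & p \notin s].
  by rewrite !inE /= in_reps // andbA.
split; first by split; lia.
split.
- move=> m mv; apply/eqP; rewrite cardfs_eq0 -fsubset0; apply/fsubsetP => p.
  rewrite inT => /and3P[/eqP E /primitive_cases[-> //|[x0 y0 xy]] _].
  by have := reduced_tail redQ x0 y0 xy; rewrite E; lia.
- rewrite cardfs_gt0; apply/fset0Pn; exists (2, -1); rewrite inT /= qeval_int.
  by apply/andP; split=> //; lia.
- move=> ab bc m m7.
  have hex x y : qeval Q x y = qa Q * (x ^+ 2 + x * y + y ^+ 2).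
    by rewrite qeval_int (_ : qb Q = qa Q) 1?(_ : qc Q = qa Q); [ring|lia|lia].
  rewrite (cardfs_split _ (s := [:: (2, -1); (1, -2)])) //= !inT /= !hex.
  rewrite [X in (_ + X)%N](_ : _ = 0%N).
    by rewrite /ind; lia.
  apply/eqP; rewrite cardfs_eq0 -fsubset0; apply/fsubsetP => -[x y].
  rewrite !inE /= in_reps // hex => /andP[/andP[/andP[/eqP E /andP[cop h]] n1] n2].
  have lt7 : x ^+ 2 + x * y + y ^+ 2 < 7 by rewrite -(ltr_pM2l a0) E; lia.
  by have := hex_values cop lt7 h; move: n1 n2; rewrite !inE; do 6?case: (_ == _).
- move=> m; rewrite {1}/prim_count (cardfs_split _ (s := s)) //=.
  have e1 : ((1, 0) \in prim_reps Q m) = (`|qa Q|%N == m).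
    by rewrite in_prim // andbT /= qeval_int; apply/eqP/eqP; lia.
  have e2 : ((0, 1) \in prim_reps Q m) = (`|qc Q|%N == m).
    by rewrite in_prim // andbT /= qeval_int; apply/eqP/eqP; lia.
  have e3 : ((1, -1) \in prim_reps Q m) = (`|(qa Q - qb Q + qc Q)%R|%N == m).
    by rewrite in_prim // andbT /= qeval_int; apply/eqP/eqP; lia.
  have e4 : ((1, 1) \in prim_reps Q m) = (`|qa Q| + `|qb Q| + `|qc Q| == m)%N.
    by rewrite in_prim // andbT /= qeval_int; apply/eqP/eqP; lia.
  by rewrite e1 e2 e3 e4 /ind addn0 !addnA.
Qed.

(** * Integral equivalence and Gauss reduction *)

Lemma mulmx2E (A B : 'M[int]_2) i j :
  (A *m B) i j = A i 0 * B 0 j + A i 1 * B 1 j.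
Proof.
rewrite mxE !big_ord_recl big_ord0 addr0.
by congr (_ + A i _ * B _ j); apply: val_inj.
Qed.

Lemma Zequiv_refl Q : Zequiv Q Q.
Proof.
exists 1%:M; first exact: unitmx1.
by move=> x y; rewrite !mxE /= !mul1r !mul0r addr0 add0r.
Qed.

Lemma Zequiv_trans Q1 Q2 Q3 : Zequiv Q1 Q2 -> Zequiv Q2 Q3 -> Zequiv Q1 Q3.
Proof.
move=> [M Mu E12] [N Nu E23]; exists (M *m N); first by rewrite unitmx_mul Mu.
move=> x y; rewrite E23 E12 !mulmx2E; congr qeval; ring.
Qed.

Definition mxact (M : 'M[int]_2) (p : int * int) : int * int :=
  (M 0 0 * p.1 + M 0 1 * p.2, M 1 0 * p.1 + M 1 1 * p.2).

Lemma mxactK M N : M *m N = 1%:M -> cancel (mxact N) (mxact M).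
Proof.
move=> MN [x y].
have I i j : M i 0 * N 0 j + M i 1 * N 1 j = (i == j)%:R by rewrite -mulmx2E MN mxE.
have E i : M i 0 * (N 0 0 * x + N 0 1 * y) + M i 1 * (N 1 0 * x + N 1 1 * y) =
  (i == 0)%:R * x + (i == 1)%:R * y by rewrite -!I; ring.
by rewrite /mxact /= !E /= !mul1r !mul0r addr0 add0r.
Qed.

Lemma Zequiv_sym Q1 Q2 : Zequiv Q1 Q2 -> Zequiv Q2 Q1.
Proof.
move=> [M Mu E]; exists (invmx M); first by rewrite unitmx_inv.
by move=> x y; rewrite E; case: (mxactK (mulmxV Mu) (x, y)) => /= -> ->.
Qed.

(** The determinant [e] is its own inverse, so [e] times the adjugate inverts the matrix. *)
Lemma Zequiv_lin Q Q' (p q r s e : int) : e * e = 1 -> p * s - q * r = e ->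
  (forall x y, qeval Q' x y = qeval Q (p * x + q * y) (r * x + s * y)) ->
  Zequiv Q Q'.
Proof.
move=> ee de H.
pose mx2 (a b c d : int) : 'M[int]_2 :=
  \matrix_(i, j) if i == 0 then if j == 0 then a else b else if j == 0 then c else d.
exists (mx2 p q r s); last by move=> x y; rewrite !mxE /=.
have : mx2 p q r s *m mx2 (e * s) (- e * q) (- e * r) (e * p) = 1%:M.
  apply/matrixP => i j; rewrite mulmx2E !mxE /=.
  by case: i j => [ [|[|//]] ?] [[|[|//]] ?] /=; rewrite -?ee -?de; ring.
by move=> /mulmx1_unit[].
Qed.

Lemma Zequiv_nreps Q Q' : Zequiv Q Q' -> reduced Q' -> nreps Q = nreps Q'.
Proof.
move=> [M Mu E] redQ; apply/funext => m.
rewrite /nreps -/(reps Q m) -/(reps Q' m).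
have -> : reps Q m = (mxact M @` reps Q' m)%classic.
  apply/seteqP; split=> [p|_ [p + <-]] /=; last by rewrite /reps /= E.
  case: p => x y pm; exists (mxact (invmx M) (x, y)); last exact: (mxactK (mulmxV Mu)).
  by rewrite /reps /= E; case: (mxactK (mulmxV Mu) (x, y)) => /= -> ->.
rewrite fset_set_image; last exact: finite_reps.
apply/eqP/card_in_imfsetP => p q _ _; apply: can_inj.
exact: mxactK (mulVmx Mu).
Qed.

(** Gauss reduction, by induction on |a| + |b| + |c|. Changing the sign of b or exchanging a and c
    preserves this sum; when 0 < a < b, replacing x by x - y lowers it. *)
Lemma reduction_ind (n : nat) (a b c : int) :
  0 < a -> 0 < c -> b ^+ 2 < 4 * a * c -> (`|a| + `|b| + `|c| <= n)%N ->
  exists2 Q, Zequiv (BQF a b c) Q & reduced Q.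
Proof.
elim: n a b c => [|n IH] a b c a0 c0 D le_n; first by lia.
wlog b0 : b D le_n / 0 <= b.
  move=> H; have [/H H0|b_lt0] := leP 0 b; first by apply: H0.
  have [Q ZQ redQ] : exists2 Q, Zequiv (BQF a (- b) c) Q & reduced Q.
    by apply: H; [rewrite sqrrN|lia|lia].
  exists Q => //; apply: Zequiv_trans ZQ.
  apply: (@Zequiv_lin _ _ 1 0 0 (-1) (-1)) => // x y.
  by rewrite !qeval_int /=; ring.
wlog ac : a c a0 c0 D le_n / a <= c.
  move=> H; have [/H H0|ca] := leP a c; first by apply: H0.
  have [Q ZQ redQ] : exists2 Q, Zequiv (BQF c b a) Q & reduced Q.
    by apply: H => //; lia.
  exists Q => //; apply: Zequiv_trans ZQ.
  apply: (@Zequiv_lin _ _ 0 1 1 0 (-1)) => // x y.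
  by rewrite !qeval_int /=; ring.
have [ba|ab] := leP b a; first by exists (BQF a b c); [exact: Zequiv_refl | split].
have D' : (b - 2 * a) ^+ 2 < 4 * a * (a - b + c) by lia.
have c'0 : 0 < a - b + c by nia.
have [Q ZQ redQ] : exists2 Q, Zequiv (BQF a (b - 2 * a) (a - b + c)) Q & reduced Q.
  by apply: IH => //; lia.
exists Q => //; apply: Zequiv_trans ZQ.
apply: (@Zequiv_lin _ _ 1 (-1) 0 1 1) => // x y.
by rewrite !qeval_int /=; ring.
Qed.

Lemma posdef_reduction (R : realType) (Q : bqf) : posdef R Q ->
  exists2 Q', Zequiv Q Q' & reduced Q'.
Proof.
move=> pd; case: Q pd => a b c pd.
have qeval_intr (x y : int) : qeval (BQF a b c) x%:~R y%:~R =
    (qeval (BQF a b c) x y)%:~R :> R.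
  by rewrite /qeval /= !intz !expr2 !intrD !intrM.
have pdZ (x y : int) : (x, y) != (0, 0) -> 0 < qeval (BQF a b c) x y.
  move=> xy0; rewrite -(ltr_int R) -qeval_intr; apply: pd.
  by move: xy0; rewrite !xpair_eqE !intr_eq0.
have := pdZ 1 0 isT; have := pdZ 0 1 isT; rewrite !qeval_int /= => c0 a0.
apply: (@reduction_ind (`|a| + `|b| + `|c|)); [lia|lia| |by []].
(* The value at (-b, 2a) is a (4ac - b^2), whose positivity gives the discriminant condition. *)
have := pdZ (- b) (2 * a); rewrite xpair_eqE negb_and qeval_int /=.
have -> : (2 * a != 0) by lia.
rewrite orbT => /(_ isT); have a0' : 0 < a by lia.
have -> : a * (- b) ^+ 2 + b * - b * (2 * a) + c * (2 * a) ^+ 2 = a * (4 * a * c - b ^+ 2).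
  by ring.
by rewrite pmulr_rgt0 // subr_gt0.
Qed.

(** * From theta series to representation numbers *)

Lemma qparam_real (R : realType) (t : R) : 0 < t -> t < 1 ->
  exists2 z : R[i], 0 < complex.Im z & qparam z = t%:C.
Proof.
move=> t0 t1; have pi0 := pi_gt0 R.
exists (0 +i* (- ln t / (2 * pi))).
  by rewrite /= divr_gt0 ?mulr_gt0 // oppr_gt0 ln_lt0 // t0.
rewrite /qparam.
have -> : 2 * (pi : R)%:C * 'i%C * (0 +i* (- ln t / (2 * pi))) = (ln t)%:C :> R[i].
  have -> : 2 = (2 : R)%:C by rewrite rmorph_nat.
  move: (pi : R) pi0 => p p0; simpc; congr (_ +i* _); field; exact: lt0r_neq0.
by rewrite /cexp /= cos0 sin0 lnK ?posrE // -[1 +i* 0]/(1 : R[i]) mulr1.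
Qed.

Lemma cvg_real_complex (R : realType) (u : R^nat) (l : R) :
  u @ \oo --> l -> (fun n => (u n)%:C : R[i]^o) @ \oo --> (l%:C : R[i]^o).
Proof.
move=> /cvgrPdist_lt ul; apply/cvgrPdist_lt => e e0.
have eE : e = (complex.Re e)%:C by rewrite RRe_real // gtr0_real.
have e0' : 0 < complex.Re e by rewrite -ltcR -eE.
apply: filterS (ul _ e0') => n.
by rewrite eE -rmorphB normc_def /= expr0n addr0 sqrtr_sqr ltcR.
Qed.

(** Trades the polynomial bound of [nreps_le] for an exponential one, so that a geometric series of
    ratio 4t <= 1/2 dominates the theta series for 0 < t <= 1/8. *)
Lemma expn_bound (m : nat) : ((4 * m).+1 ^ 2 <= 25 * 4 ^ m)%N.
Proof.
have H : ((4 * m).+1 <= 5 * 2 ^ m)%N.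
  elim: m => [|m IH]; rewrite ?expnS //.
  by have := expn_gt0 2 m; lia.
have -> : (25 * 4 ^ m = (5 * 2 ^ m) ^ 2)%N.
  by rewrite expnMn -(expnM 2 m) [(m * 2)%N]mulnC (expnM 2 2).
  
by rewrite leq_exp2r.
Qed.

Lemma half_pow_sum (R : realFieldType) (x : R) (k : nat) :
  0 <= x -> x <= 2^-1 -> \sum_(j < k) x ^+ j <= 2.
Proof.
move=> x0 x1; elim: k => [|k IH]; first by rewrite big_ord0.
rewrite big_ord_recl expr0.
have -> : \sum_(i < k) x ^+ lift ord0 i = x * \sum_(i < k) x ^+ i.
  by rewrite mulr_sumr; apply: eq_bigr => i _; rewrite -exprS.
have S0 : 0 <= \sum_(i < k) x ^+ i by apply: sumr_ge0 => i _; exact: exprn_ge0.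
nra.
Qed.

(** Once the lower coefficients vanish, f n t^n is bounded by a multiple of t^(n+1), so |f n| <= K t
    for all small t. *)
Lemma power_series_eq0 (R : realType) (f : R^nat) (C : R) :
  (forall m, `|f m| <= C * 4 ^+ m) ->
  (forall t, 0 < t -> t <= 8^-1 ->
     series (fun m => f m * t ^+ m) @ \oo --> (0 : R)) ->
  forall m, f m = 0.
Proof.
move=> fC f0 n; elim/ltn_ind: n => n IH.
have C0 : 0 <= C by have := fC 0%N; rewrite mulr1; exact: le_trans.
(* The first summand bounds the terms after the n-th, through a geometric sum at most 2; the final 1
   absorbs the distance of the chosen partial sum from its limit 0, which is at most t^(n+1). *)
pose K := 2 * C * 4 ^+ n.+1 + 1.
have K0 : 0 < K by rewrite ltr_wpDl // mulr_ge0 ?exprn_ge0 // mulr_ge0.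
have bound t : 0 < t -> t <= 8^-1 -> `|f n| <= K * t.
  move=> t0 t8.
  have tn0 : 0 < t ^+ n by exact: exprn_gt0.
  have /cvgr0_norm_le /(_ _ (exprn_gt0 n.+1 t0)) [N _ HN] := f0 t t0 t8.
  have := HN (n.+1 + N)%N (leq_addl _ _) => /=.
  rewrite /series /= big_mkord big_split_ord /= big_ord_recr /= big1 ?add0r; last first.
    by move=> i _; rewrite IH ?mul0r.
  set T := \sum_(i < N) _ => HT.
  have T_le : `|T| <= 2 * C * 4 ^+ n.+1 * t ^+ n.+1.
    apply: le_trans (ler_norm_sum _ _ _) _.
    have -> : 2 * C * 4 ^+ n.+1 * t ^+ n.+1 = C * (4 * t) ^+ n.+1 * 2 by rewrite exprMn; ring.
    apply: le_trans (_ : \sum_(i < N) C * (4 * t) ^+ n.+1 * (4 * t) ^+ i <= _).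
      apply: ler_sum => i _; rewrite normrM -mulrA -exprD exprMn mulrA.
      rewrite [X in _ * X](ger0_norm (exprn_ge0 _ (ltW t0))).
      by apply: ler_wpM2r; [exact: exprn_ge0 (ltW t0) | exact: fC].
    rewrite -mulr_sumr ler_wpM2l ?half_pow_sum //; [|lra|lra].
    by rewrite mulr_ge0 // exprn_ge0; lra.
  have E : f n * t ^+ n = f n * t ^+ n + T - T by rewrite addrK.
  have : `|f n| * t ^+ n <= K * t * t ^+ n.
    rewrite -{1}(ger0_norm (ltW tn0)) -normrM E.
    apply: le_trans (ler_normB _ _) _.
    have -> : K * t * t ^+ n = t ^+ n.+1 + 2 * C * 4 ^+ n.+1 * t ^+ n.+1.
      by rewrite /K !exprS; ring.
    exact: lerD.
  by rewrite ler_pM2r.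
apply/eqP; rewrite -normr_le0 leNgt; apply/negP => fn0.
have [t [t0 t8 tK]] : exists t, [/\ 0 < t, t <= 8^-1 & K * t < `|f n|].
  exists (Num.min 8^-1 (`|f n| / (2 * K))); split.
  - by rewrite lt_min divr_gt0 ?mulr_gt0 // andbT; lra.
  - by rewrite ge_min lexx.
  - have h : Num.min 8^-1 (`|f n| / (2 * K)) <= `|f n| / (2 * K) by rewrite ge_min lexx orbT.
    apply: le_lt_trans (ler_wpM2l (ltW K0) h) _.
    have -> : K * (`|f n| / (2 * K)) = `|f n| / 2 by field; exact: lt0r_neq0.
    by rewrite ltr_pdivrMr //; lra.
by have := bound t t0 t8; rewrite leNgt tK.
Qed.

Lemma theta_real (R : realType) (Q : bqf) (z : R[i]) (t : R) :
  (forall m, (nreps Q m <= 25 * 4 ^ m)%N) ->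
  0 < t -> t <= 8^-1 -> qparam z = t%:C ->
  exists2 l : R, series (fun m => (nreps Q m)%:R * t ^+ m) @ \oo --> l
    & theta Q z = l%:C.
Proof.
move=> le_r t0 t8 zt.
have cv : cvgn (series (fun m => (nreps Q m)%:R * t ^+ m : R)).
  apply: (@series_le_cvg _ _ (geometric 25 (4 * t))).
  - by move=> m; rewrite mulr_ge0 // exprn_ge0 // ltW.
  - by move=> m; rewrite /= mulr_ge0 // exprn_ge0 //; lra.
  - move=> m; rewrite /= exprMn mulrA; apply: ler_wpM2r; first exact: exprn_ge0 (ltW t0).
    by rewrite -natrX -natrM ler_nat.
  - apply: is_cvg_geometric_series; rewrite ger0_norm; lra.
set l : R := limn (series (fun m => (nreps Q m)%:R * t ^+ m : R)) in cv *.
exists l => //.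
rewrite /theta zt; set u := series _;
suff ul : u @ \oo --> (l%:C : R[i]^o) by exact: (cvg_lim (@norm_hausdorff _ _) ul).
apply: cvg_trans (cvg_real_complex cv).
apply: near_eq_cvg; near=> n.
rewrite /series /= rmorph_sum; apply: eq_bigr => i _.
by rewrite rmorphM rmorphXn rmorph_nat.
Unshelve. all: by end_near.
Qed.

Lemma theta_relation_coeff (R : realType) (Q : 'I_3 -> bqf) (alpha : 'I_3 -> R) :
  (forall i m, (nreps (Q i) m <= 25 * 4 ^ m)%N) ->
  (forall z : R[i], 0 < complex.Im z ->
      (alpha 0)%:C * theta (Q 0) z + (alpha 1)%:C * theta (Q 1) z
        + (alpha 2)%:C * theta (Q 2) z = 0) ->
  forall m, alpha 0 * (nreps (Q 0) m)%:R + alpha 1 * (nreps (Q 1) m)%:R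
     + alpha 2 * (nreps (Q 2) m)%:R = 0.
Proof.
move=> le_r rel.
apply: (@power_series_eq0 _ _ (25 * (`|alpha 0| + `|alpha 1| + `|alpha 2|))) => [m|t t0 t8].
  have bnd i : `|alpha i * (nreps (Q i) m)%:R| <= `|alpha i| * (25 * 4 ^+ m).
    by rewrite normrM normr_nat ler_wpM2l // -natrX -natrM ler_nat.
  apply: le_trans (ler_normD _ _) _; apply: le_trans (lerD (ler_normD _ _) (lexx _)) _.
  have := bnd 0; have := bnd 1; have := bnd 2; lra.
have [|z z0 zt] := qparam_real t0; first by lra.
have [l0 cv0 th0] := theta_real (le_r 0) t0 t8 zt.
have [l1 cv1 th1] := theta_real (le_r 1) t0 t8 zt.
have [l2 cv2 th2] := theta_real (le_r 2) t0 t8 zt.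
have := rel z z0; rewrite th0 th1 th2 -!rmorphM -!rmorphD => /eqP.
rewrite -(rmorph0 (real_complex R)) (inj_eq (@complexI _)) => /eqP sum0.
pose S i : R^nat := series (fun m => (nreps (Q i) m)%:R * t ^+ m).
have cvD : (fun n => alpha 0 * S 0 n + alpha 1 * S 1 n + alpha 2 * S 2 n) @ \oo
    --> alpha 0 * l0 + alpha 1 * l1 + alpha 2 * l2.
  by apply: cvgD; [apply: cvgD|]; exact: cvgMl_tmp.
rewrite sum0 in cvD; apply: cvg_trans cvD; apply: near_eq_cvg; near=> n.
rewrite /S /series /= !mulr_sumr -!big_split /=; apply: eq_bigr => i _; ring.
Unshelve. all: by end_near.
Qed.

(** * Linear relations between reduced forms *)

Lemma profile_relation_sym (R : realFieldType) (p q : R)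
    (a1 b1 c1 a2 b2 c2 a3 b3 c3 : nat) (h1 h2 h3 : nat -> nat) :
  profile a1 b1 c1 h1 -> profile a2 b2 c2 h2 -> profile a3 b3 c3 h3 ->
  0 < p -> 0 < q ->
  (forall m, (0 < m)%N ->
     p * (h1 m)%:R + q * (h2 m)%:R = (p + q) * (h3 m)%:R) ->
  [\/ (a1, b1, c1) = (a3, b3, c3) /\ (a2, b2, c2) = (a3, b3, c3),
   [/\ q = 2 * p, (a1, b1, c1) = (a1, a1, a1),
      (a2, b2, c2) = (4 * a1, 4 * a1, 4 * a1)%N
    & (a3, b3, c3) = (a1, 0, 3 * a1)%N] |
   [/\ p = 2 * q, (a2, b2, c2) = (a2, a2, a2),
      (a1, b1, c1) = (4 * a2, 4 * a2, 4 * a2)%N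
    & (a3, b3, c3) = (a2, 0, 3 * a2)%N]].
Proof.
move=> P1 P2 P3 p0 q0 rel.
have rel' m : (0 < m)%N -> q * (h2 m)%:R + p * (h1 m)%:R = (q + p) * (h3 m)%:R.
  by move=> /rel; lra.
have : [/\ (a1 <= a2)%N, (a1 = a2 -> c1 <= c2)%N & (a1 = a2 -> c1 = c2 -> b2 <= b1)%N]
    \/ [/\ (a2 <= a1)%N, (a2 = a1 -> c2 <= c1)%N & (a2 = a1 -> c2 = c1 -> b1 <= b2)%N].
  case: (ltngtP a1 a2) => ?; [by left; split; lia|by right; split; lia|].
  case: (ltngtP c1 c2) => ?; [by left; split; lia|by right; split; lia|].
  by case: (leqP b2 b1) => ?; [left; split; lia|right; split; lia].
case=> [ [le1 le2 le3]|[le1 le2 le3]].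
  by case: (profile_relation P1 P2 P3 p0 q0 le1 le2 le3 rel) => H; [constructor 1|constructor 2].
by case: (profile_relation P2 P1 P3 q0 p0 le1 le2 le3 rel') => [ []|] *;
  [constructor 1|constructor 3].
Qed.

(** The equality is read as h + h' = 2 h' with weights 1 and 1; the exceptional solutions need
    weights in ratio 2. *)
Lemma profile_inj (a b c a' b' c' : nat) (h h' : nat -> nat) :
  profile a b c h -> profile a' b' c' h' -> (forall m, (0 < m)%N -> h m = h' m) ->
  (a, b, c) = (a', b', c').
Proof.
move=> P P' hh'.
have := @profile_relation_sym rat 1 1 _ _ _ _ _ _ _ _ _ _ _ _ P P' P' ltr01 ltr01.
by case=> [m /hh' ->|[//]|[e _ _ _]|[e _ _ _]]; [ring|exfalso; lra|exfalso; lra].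
Qed.

Lemma reduced_eq (Q Q' : bqf) : reduced Q -> reduced Q' ->
  (`|qa Q|, `|qb Q|, `|qc Q|)%N = (`|qa Q'|, `|qb Q'|, `|qc Q'|)%N -> Q = Q'.
Proof.
case: Q Q' => [a b c] [a' b' c'] [/= ? ? ? ?] [/= ? ? ? ?] [] ? ? ?.
by congr BQF; lia.
Qed.

Lemma reduced_relation (R : realFieldType) (p q : R) (Q1 Q2 Q3 : bqf) :
  reduced Q1 -> reduced Q2 -> reduced Q3 -> 0 < p -> 0 < q ->
  (forall m, (0 < m)%N -> p * (prim_count Q1 m)%:R + q * (prim_count Q2 m)%:R =
     (p + q) * (prim_count Q3 m)%:R) ->
  [\/ Q1 = Q3 /\ Q2 = Q3,
   exists2 c : int, 0 < c & [/\ q = 2 * p, Q1 = BQF c c c,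
      Q2 = BQF (4 * c) (4 * c) (4 * c) & Q3 = BQF c 0 (3 * c)] |
   exists2 c : int, 0 < c & [/\ p = 2 * q, Q2 = BQF c c c,
      Q1 = BQF (4 * c) (4 * c) (4 * c) & Q3 = BQF c 0 (3 * c)]].
Proof.
move=> r1 r2 r3 p0 q0 rel.
have := profile_relation_sym (prim_count_profile r1) (prim_count_profile r2)
  (prim_count_profile r3) p0 q0 rel.
case=> [ [e1 e2]|[e e1 e2 e3]|[e e1 e2 e3]].
- by constructor 1; split; apply: reduced_eq.
- constructor 2; exists (qa Q1); first by case: r1.
  case: Q1 Q2 Q3 r1 r2 r3 e1 e2 e3 {rel} => [a b c] [a' b' c'] [a'' b'' c''].
  move=> [/= ? ? ? ?] [/= ? ? ? ?] [/= ? ? ? ?] [] ? ? [] ? ? ? [] ? ? ?.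
  by split; [exact: e|congr BQF; lia|congr BQF; lia|congr BQF; lia].
- constructor 3; exists (qa Q2); first by case: r2.
  case: Q1 Q2 Q3 r1 r2 r3 e1 e2 e3 {rel} => [a b c] [a' b' c'] [a'' b'' c''].
  move=> [/= ? ? ? ?] [/= ? ? ? ?] [/= ? ? ? ?] [] ? ? [] ? ? ? [] ? ? ?.
  by split; [exact: e|congr BQF; lia|congr BQF; lia|congr BQF; lia].
Qed.

Lemma nreps0 (Q : bqf) : reduced Q -> nreps Q 0 = 1%N.
Proof.
move=> redQ; rewrite /nreps -/(reps Q 0).
have -> : fset_set (reps Q 0) = [fset (0, 0)]%fset.
  apply/fsetP => -[x y]; rewrite in_reps // inE /=; apply/eqP/eqP => [E|[-> ->]].
    by have := reduced_box x y redQ; rewrite E => -[? ?]; congr (_, _); lia.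
  by rewrite qeval_int; lia.
by rewrite cardfs1.
Qed.

(** At 0 only the zero vector counts. For m > 0, the terms of [nreps_prim] with d > 1 concern the
    smaller number m / d^2 and cancel by induction, leaving the term d = 1. *)
Lemma prim_relation (R : realFieldType) (I : finType) (alpha : I -> R) (Q : I -> bqf) :
  (forall i, reduced (Q i)) ->
  (forall m, \sum_i alpha i * (nreps (Q i) m)%:R = 0) ->
  \sum_i alpha i = 0 /\
  forall m, (0 < m)%N -> \sum_i alpha i * (prim_count (Q i) m)%:R = 0.
Proof.
move=> redQ rel; split.
  by rewrite -[RHS](rel 0%N); apply: eq_bigr => i _; rewrite nreps0 ?mulr1.
move=> m; elim/ltn_ind: m => m IH m0.
pose c (d : 'I_m.+1) n := (if (0 < d)%N && (d ^ 2 %| m)%N then 2 * n else 0)%N.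
have E : \sum_(d < m.+1) \sum_i alpha i * (c d (prim_count (Q i) (m %/ d ^ 2)))%:R = 0.
  rewrite -[RHS](rel m) exchange_big; apply: eq_bigr => i _.
  by rewrite (nreps_prim (redQ i) m0) natr_sum mulr_sumr.
pose d1 : 'I_m.+1 := Ordinal (m0 : 1 < m.+1)%N.
move: E; rewrite (bigD1 d1) //= [X in _ + X]big1 ?addr0 => [E|d d_neq1].
  suff : 2 * \sum_i alpha i * (prim_count (Q i) m)%:R = 0 by lra.
  rewrite -[RHS]E mulr_sumr; apply: eq_bigr => i _.
  by rewrite /c /= dvd1n divn1 natrM; ring.
rewrite /c; have [/andP[d0 dm]|_] := boolP ((0 < d)%N && _); last first.
  by rewrite big1 // => i _; rewrite mulr0.
have d2 : (1 < d)%N by move: d_neq1; rewrite -val_eqE /=; lia.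
have F : \sum_i alpha i * (prim_count (Q i) (m %/ d ^ 2))%:R = 0.
  apply: IH; first by rewrite ltn_Pdiv // -mulnn; nia.
  by rewrite divn_gt0 ?expn_gt0 ?d0 // dvdn_leq.
transitivity (2 * \sum_i alpha i * (prim_count (Q i) (m %/ d ^ 2))%:R).
  by rewrite mulr_sumr; apply: eq_bigr => i _; rewrite natrM; ring.
by rewrite F mulr0.
Qed.

(** * Every relation has one of the four types *)

Lemma ord3P (i : 'I_3) : [\/ i = 0, i = 1 | i = 2].
Proof.
by case: i => [ [|[|[|//]]] ?]; [constructor 1 | constructor 2 | constructor 3]; apply: val_inj.
Qed.

Lemma perm3 (i j k : 'I_3) : i != j -> j != k -> i != k ->
  exists s : 'S_3, [/\ s 0 = i, s 1 = j & s 2 = k].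
Proof.
move=> ij jk ik.
pose f (x : 'I_3) := if x == 0 then i else if x == 1 then j else k.
have f_inj : injective f.
  move=> x y; rewrite /f.
  by case: (ord3P x) => ->; case: (ord3P y) => -> //= e; move: ij jk ik; rewrite e eqxx.
by exists (perm f_inj); rewrite !permE.
Qed.

Lemma sum3_perm (V : zmodType) (F : 'I_3 -> V) (s : 'S_3) :
  \sum_i F i = F (s 0) + F (s 1) + F (s 2).
Proof.
rewrite (reindex_inj (@perm_inj _ s)) !big_ord_recl big_ord0 /= addr0 addrA.
by congr (_ + F (s _) + F (s _)); apply: val_inj.
Qed.

Lemma exists_type (R : realType) (Q : 'I_3 -> bqf) (alpha : 'I_3 -> R) :
  (forall i, posdef R (Q i)) ->
  (forall z : R[i], 0 < complex.Im z ->
      (alpha 0)%:C * theta (Q 0) z + (alpha 1)%:C * theta (Q 1) z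
        + (alpha 2)%:C * theta (Q 2) z = 0) ->
  exists t (s : 'S_3), has_type t (alpha \o s) (Q \o s).
Proof.
move=> pd rel.
have /choice[P /all_and2[ZP redP]] : forall i, exists P, Zequiv (Q i) P /\ reduced P.
  by move=> i; have [P ZP redP] := posdef_reduction (pd i); exists P.
have nrepsE i : nreps (Q i) = nreps (P i) by exact: Zequiv_nreps.
have sum1 (V : zmodType) (F : 'I_3 -> V) : \sum_i F i = F 0 + F 1 + F 2.
  by rewrite (sum3_perm F 1%g) !perm1.
have [|alpha0 rel_prim] := prim_relation (alpha := alpha) redP.
  move=> m; rewrite sum1 -!nrepsE; apply: theta_relation_coeff rel m => i m.
  by rewrite nrepsE; apply: leq_trans (nreps_le _ (redP i)) (expn_bound m).
have Z_eq i j : P i = P j -> Zequiv (Q i) (Q j).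
  by move=> e; apply: Zequiv_trans (ZP i) _; rewrite e; apply/Zequiv_sym/ZP.
have [/forallP all0|] := boolP [forall i, alpha i == 0].
  by exists Degenerate, 1%g => i /=; apply/eqP.
rewrite negb_forall => /existsP[i i0].
have [/existsP[k /eqP k0]|] := boolP [exists k, alpha k == 0].
  have ik : i != k by apply: contraNneq i0 => ->; rewrite k0.
  have [j ji jk] : exists2 j, j != i & j != k.
    by move: ik; case: (ord3P i) => ->; case: (ord3P k) => -> // _;
    solve [by exists 0 | by exists 1 | by exists 2].
  have [|s [s0 s1 s2]] := @perm3 i j k _ jk ik; first by rewrite eq_sym.
  have aij : alpha i = - alpha j.
    by apply/eqP; rewrite -addr_eq0; move: alpha0; rewrite (sum3_perm _ s) s0 s1 s2 k0 addr0 => ->.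
  exists Trivial2, s; split; rewrite /= ?s0 ?s1 ?s2 //.
  (* The two remaining coefficients are opposite, so the primitive counts agree, and these determine
     a reduced form. *)
  apply: Z_eq; apply: reduced_eq => //.
  apply: profile_inj (prim_count_profile (redP i)) (prim_count_profile (redP j)) _ => m.
  move=> /rel_prim; rewrite (sum3_perm _ s) s0 s1 s2 k0 mul0r addr0 aij mulNr => /eqP.
  rewrite addrC subr_eq0 => /eqP /mulfI E; apply/eqP; rewrite -(eqr_nat R) E //.
  by rewrite -oppr_eq0 -aij.
rewrite negb_exists => /forallP nz.
(* No coefficient vanishes from here on; [key] assumes that [s] puts two coefficients of the same
   sign first. *)
have key (s : 'S_3) : (0 < alpha (s 0)) = (0 < alpha (s 1)) ->
    exists t (s : 'S_3), has_type t (alpha \o s) (Q \o s).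
  move=> sgn; pose a := alpha (s 0); pose b := alpha (s 1).
  have a2 : alpha (s 2) = - (a + b).
    by apply/eqP; rewrite -addr_eq0 addrC; move: alpha0; rewrite (sum3_perm _ s) => ->.
  have prel (e : R) m : (0 < m)%N -> e * a * (prim_count (P (s 0)) m)%:R +
     e * b * (prim_count (P (s 1)) m)%:R = (e * a + e * b) * (prim_count (P (s 2)) m)%:R.
    move=> /rel_prim; rewrite (sum3_perm _ s) a2 -/a -/b => E; apply/eqP.
    by rewrite -subr_eq0 -[X in _ == X](mulr0 e) -E; apply/eqP; ring.
  (* The factor [e] is the common sign of the two coefficients, making both weights positive. *)
  have [e [e0 ea eb]] : exists e, [/\ e != 0, 0 < e * a & 0 < e * b].
    have an := nz (s 0); have bn := nz (s 1); rewrite -/a -/b in an bn sgn.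
    have [ap|an'] := ltP 0 a; [exists 1|exists (-1)]; split;
      rewrite ?oppr_eq0 ?oner_eq0 ?mul1r ?mulN1r ?oppr_gt0 //.
    + by rewrite -sgn.
    + by rewrite lt_neqAle an.
    + by rewrite lt_neqAle bn leNgt -sgn -leNgt.
  have nontriv (s' : 'S_3) c : s' 2 = s 2 -> 0 < c -> alpha (s' 1) = 2 * alpha (s' 0) ->
      P (s' 0) = BQF c c c -> P (s' 1) = BQF (4 * c) (4 * c) (4 * c) ->
      P (s' 2) = BQF c 0 (3 * c) -> has_type Nontrivial3 (alpha \o s') (Q \o s').
    move=> s'2 c0 a1E P0 P1 P2.
    have a2E : alpha (s' 2) = - 3 * alpha (s' 0).
      by move: alpha0; rewrite (sum3_perm _ s') a1E; lra.
    split=> /=; [by rewrite a1E; ring | by rewrite a1E a2E; ring | | |].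
    - by rewrite mulf_neq0 // oppr_eq0.
    - move=> z z0; have := rel z z0.
      rewrite -(sum1 _ (fun i => (alpha i)%:C * theta (Q i) z)) (sum3_perm _ s') a1E a2E.
      move: (nz (s' 0)); rewrite -(inj_eq (@complexI R)).
      rewrite !rmorphM rmorphN !rmorph_nat /=.
      move: (alpha (s' 0))%:C (theta _ z) (theta _ z) (theta _ z) => u x y w u0 E.
      have {}u0 : u != 0 by rewrite -(rmorph0 (real_complex R)).
      apply: (mulfI u0); apply/eqP; rewrite -subr_eq0; apply/eqP.
      rewrite -[RHS](mulr0 3^-1) -E; by field.
    - exists c. split=> //; [rewrite -P0 | rewrite -P1 | rewrite -P2]; exact: ZP.
  case: (reduced_relation (redP _) (redP _) (redP _) ea eb (prel e)).
  - move=> [P02 P12]; exists Trivial3, s; split=> /=.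
    + by move=> l; exact: nz.
    + by rewrite a2 /a /b; ring.
    + by apply: Z_eq; rewrite P02.
    + exact: Z_eq.
  - move=> [c c0 [ab P0 P1 P2]]; exists Nontrivial3, s; apply: nontriv P0 P1 P2 => //.
    by apply: (mulfI e0); rewrite ab /a; ring.
  - move=> [c c0 [ab P1 P0 P2]].
    (* The second form is here the smaller hexagonal one, so the first two indices are exchanged. *)
    have [|||s' [s'0 s'1 s'2]] := @perm3 (s 1) (s 0) (s 2); rewrite ?(inj_eq perm_inj) //.
    exists Nontrivial3, s'; apply: (nontriv _ c) => //; rewrite ?s'0 ?s'1 ?s'2 //.
    by apply: (mulfI e0); rewrite -/a ab /b; ring.
have key3 (i' j k : 'I_3) : i' != j -> j != k -> i' != k ->
    (0 < alpha i') = (0 < alpha j) -> exists t (s : 'S_3), has_type t (alpha \o s) (Q \o s).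
  by move=> ij jk ik ?; have [s [s0 s1 s2]] := perm3 ij jk ik; apply: (key s); rewrite s0 s1.
(* Among three nonzero reals, two have the same sign. *)
have [e01|n01] := eqVneq (0 < alpha 0) (0 < alpha 1); first exact: (key3 0 1 2).
have [e02|n02] := eqVneq (0 < alpha 0) (0 < alpha 2); first exact: (key3 0 2 1).
apply: (key3 1 2 0) => //.
by move: n01 n02; do 3!case: (0 < _).
Qed.

(** * The four types exclude one another *)

(** The first form takes only multiples of 4c, while the second takes the value c at (1, 0). *)
Lemma hex_not_equiv (c : int) : 0 < c ->
  ~ Zequiv (BQF (4 * c) (4 * c) (4 * c)) (BQF c c c).
Proof.
move=> c0 [M _ /(_ 1 0)]; rewrite !qeval_int /=.
move: (M 0 0 * 1 + _) (M 1 0 * 1 + _) => x y E.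
have : c * (4 * (x ^+ 2 + x * y + y ^+ 2)) = c * 1 by rewrite mulr1; lia.
by move/(mulfI (lt0r_neq0 c0)); lia.
Qed.

(* A property of alpha and Q not depending on the ordering of the indices which
   separates the four types. *)
Definition type_mark (R : realType) (t : solution_type)
    (alpha : 'I_3 -> R) (Q : 'I_3 -> bqf) : Prop :=
  match t with
  | Degenerate => forall i, alpha i = 0
  | Trivial2 => (exists i, alpha i = 0) /\ exists i, alpha i != 0
  | Trivial3 => (forall i, alpha i != 0) /\ forall i j, Zequiv (Q i) (Q j)
  | Nontrivial3 => (forall i, alpha i != 0) /\ exists i j, ~ Zequiv (Q i) (Q j)
  end.

Lemma has_type_mark (R : realType) t (alpha : 'I_3 -> R) (Q : 'I_3 -> bqf) (s : 'S_3) :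
  has_type t (alpha \o s) (Q \o s) -> type_mark t alpha Q.
Proof.
have all_s (P : 'I_3 -> Prop) : P (s 0) -> P (s 1) -> P (s 2) -> forall i, P i.
  by move=> P0 P1 P2 i; rewrite -(permKV s i); case: (ord3P (s^-1%g i)) => ->.
case: t => /=.
- by move=> H; apply: all_s.
- by move=> [_ a0 a2 _]; split; [exists (s 2) | exists (s 0)].
- move=> [a0 _ Q01 Q12]; split; first by apply: all_s.
  have Q0 : forall i, Zequiv (Q (s 0)) (Q i).
    by apply: all_s => //; [exact: Zequiv_refl | exact: Zequiv_trans Q12].
  by move=> i j; apply: Zequiv_trans (Q0 j); apply: Zequiv_sym.
- move=> [a01 a12 a2 _ [c [c0 Q0 Q1 _]]]; split; last first.
    exists (s 1), (s 0) => Q10; apply: (hex_not_equiv c0).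
    exact: Zequiv_trans (Zequiv_sym Q1) (Zequiv_trans Q10 Q0).
  have a2' : alpha (s 2) != 0 by apply: contraNneq a2 => ->; rewrite mulr0.
  apply: all_s => //.
    by apply: contraNneq a2 => a00; rewrite -a12 -a01 a00 mulr0.
  by apply: contraNneq a2 => a00; rewrite -a12 a00 mulr0.
Qed.

Lemma type_mark_uniq (R : realType) t t' (alpha : 'I_3 -> R) (Q : 'I_3 -> bqf) :
  type_mark t alpha Q -> type_mark t' alpha Q -> t = t'.
Proof.
have nz i : alpha i != 0 -> alpha i = 0 -> False by move=> /eqP.
case: t => /= [H|[[k k0] [i i0]]|[H E]|[H [i [j nE]]]]; case: t' => //=.
- by move=> [_ [i /nz]] [].
- by move=> [/(_ 0) /nz] [].
- by move=> [/(_ 0) /nz] [].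
- by move=> H; case: (nz i).
- by move=> [H _]; case: (nz k).
- by move=> [H _]; case: (nz k).
- by move=> H'; case: (nz 0).
- by move=> [ [k k0] _]; case: (nz k).
- by move=> [_ [i [j]]] [].
- by move=> H'; case: (nz 0).
- by move=> [ [k k0] _]; case: (nz k).
- by move=> [_ E]; case: nE.
Qed.

Theorem theorem1p1 (R : realType) (Q : 'I_3 -> bqf) (alpha : 'I_3 -> R)
    (Qpos : forall i, posdef R (Q i))
    (rel : forall z : R[i], 0 < complex.Im z ->
      (alpha 0)%:C * theta (Q 0) z + (alpha 1)%:C * theta (Q 1) z
        + (alpha 2)%:C * theta (Q 2) z = 0) :
  exists! t : solution_type,
    exists s : 'S_3, has_type t (alpha \o s) (Q \o s).
Proof.
have [t [s ts]] := exists_type Qpos rel.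
exists t; split=> [|t' [s' ts']]; first by exists s.
exact: type_mark_uniq (has_type_mark ts) (has_type_mark ts').
Qed.
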